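(* Let $M$ be a $0/\pm1$ matrix. Then the growth rate $\mathrm{gr}(\mathrm{Geom}(M))=\lim_{n\to\infty} g_n^{1/n}$ exists (where $g_n$ is the number of permutations of length $n$ in $\mathrm{Geom}(M)$), and it is equal to the square of the largest root of the matching polynomial $\mu_{G(M^{\times 2})}(z)$, where $G(M^{\times2})$ is the row-column graph of the double refinement of $M$.
   Context: A $0/\pm1$ matrix $M$ of dimensions $t\times u$ ($t$ columns, $u$ rows) is indexed from the lower left, $M_{i,j}$ being the entry in column $i$ and row $j$. Its standard figure $\Lambda_M\subseteq\mathbb{R}^2$ is the union, over all $(i,j)$ with $M_{i,j}\neq0$, of the open line segment $L_{i,j}$ from $(i-1,j-1)$ to $(i,j)$ if $M_{i,j}=1$, and from $(i-1,j)$ to $(i,j-1)$ if $M_{i,j}=-1$. The geometric grid class $\mathrm{Geom}(M)$ is the set of permutations $\sigma_1\cdots\sigma_n$ for which there exist points $(x_1,y_1),\dots,(x_n,y_n)\in\Lambda_M$ with $x_1<\dots<x_n$ and $y_1,\dots,y_n$ order-isomorphic to $\sigma_1,\dots,\sigma_n$. The row-column graph $G(M)$ is the bipartite graph with one vertex for each column and one vertex for each row of $M$, the column-$i$ vertex being adjacent to the row-$j$ vertex iff $M_{i,j}\neq0$ (the edge is labelled by $M_{i,j}$). The double refinement $M^{\times2}$ is the $2t\times 2u$ $0/\pm1$ matrix obtained by replacing each entry $0$ by a $2\times2$ block of zeros, each entry $1$ by the $2\times2$ block having $1$ in its lower-left and upper-right positions and $0$ elsewhere, and each entry $-1$ by the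 $2\times2$ block having $-1$ in its upper-left and lower-right positions and $0$ elsewhere. For a graph $G$ on $n$ vertices with $m_k(G)$ denoting the number of $k$-matchings (sets of $k$ pairwise vertex-disjoint edges), the matching polynomial is $\mu_G(z)=\sum_{k=0}^{\lfloor n/2\rfloor}(-1)^k m_k(G) z^{n-2k}$. *)

(* Defs.v *)
From mathcomp Require Import all_boot all_order all_algebra all_fingroup.
From mathcomp Require Import all_classical all_reals all_analysis.

Set Implicit Arguments.
Unset Strict Implicit.
Unset Printing Implicit Defensive.

Import Order.TTheory GRing.Theory Num.Theory.
Import numFieldNormedType.Exports.

Local Open Scope classical_set_scope.
Local Open Scope ring_scope.

(* A matrix M : 'M[int]_(t, u) is indexed in Cartesian fashion from the lower
   left: M i j is the entry in column i (counted from the left) and row j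
   (counted from the bottom), so t is the number of columns and u the number of
   rows. Indices start from 0, so the cell (i, j) is the unit square with lower
   left corner (i, j). *)
Definition zpm1_matrix (t u : nat) (M : 'M[int]_(t, u)) : Prop :=
  forall i j, M i j \in [:: 0; 1; -1].

Section Geom.
Context {R : realType}.

Definition open_segment (p q : R * R) : set (R * R) :=
  [set ((1 - s) * p.1 + s * q.1, (1 - s) * p.2 + s * q.2) |
     s in [set s : R | 0 < s < 1]].

Definition cell_segment (i j : nat) (c : int) : set (R * R) :=
  if c == 1 then open_segment (i%:R, j%:R) (i.+1%:R, j.+1%:R)
  else if c == -1 then open_segment (i%:R, j.+1%:R) (i.+1%:R, j%:R)
  else set0.

Definition standard_figure (t u : nat) (M : 'M[int]_(t, u)) : set (R * R) :=
  [set p | exists (i : 'I_t) (j : 'I_u), cell_segment i j (M i j) p].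

(* The permutations of length n in Geom(M). *)
Definition Geom (t u : nat) (M : 'M[int]_(t, u)) (n : nat) : set 'S_n :=
  [set s : 'S_n | exists x y : 'I_n -> R,
     [/\ forall a : 'I_n, standard_figure M (x a, y a),
         forall a b : 'I_n, (a < b)%N -> x a < x b
       & forall a b : 'I_n, (y a < y b) = (s a < s b)%N]].

Arguments Geom {t u} M n.

Definition Geom_count (t u : nat) (M : 'M[int]_(t, u)) (n : nat) : nat :=
  #|[pred s : 'S_n | `[< Geom M n s >]]|.

Definition has_growth_rate (g : nat -> nat) (r : R) : Prop :=
  (fun n : nat => (g n)%:R `^ (n%:R)^-1 : R) @ \oo --> r.

End Geom.

(* R occurs only in the existential over the points, so it is not inferable. *)
Arguments Geom R {t u} M n.
Arguments Geom_count R {t u} M n.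

Definition row_column_graph (t u : nat) (M : 'M[int]_(t, u)) :
    rel ('I_t + 'I_u)%type :=
  fun v w => match v, w with
  | inl i, inr j | inr j, inl i => M i j != 0
  | _, _ => false
  end.

Lemma row_column_graph_sym (t u : nat) (M : 'M[int]_(t, u)) :
  symmetric (row_column_graph M).
Proof. by case=> v [] w. Qed.

Lemma row_column_graph_irr (t u : nat) (M : 'M[int]_(t, u)) :
  irreflexive (row_column_graph M).
Proof. by case. Qed.

Definition half_ord (t : nat) (i : 'I_t.*2) : 'I_t :=
  Ordinal (etrans (ltn_half_double i t) (ltn_ord i)).

(* The block of an entry 1 is nonzero on its lower-left and upper-right cells,
   i.e., where the column and row indices have the same parity; that of an
   entry -1 is nonzero on the other two cells. *)
Definition double_refinement (t u : nat) (M : 'M[int]_(t, u)) :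
    'M[int]_(t.*2, u.*2) :=
  \matrix_(i < t.*2, j < u.*2)
    let c := M (half_ord i) (half_ord j) in
    if c == 1 then (if odd i == odd j then 1 else 0)
    else if c == -1 then (if odd i != odd j then -1 else 0)
    else 0.

(* A simple graph on T is a symmetric irreflexive relation e; its edges are
   the two-element sets of adjacent vertices. *)
Definition edges (T : finType) (e : rel T) : {set {set T}} :=
  [set A : {set T} |
     [exists v, exists w, e v w && (A == [set v; w]%SET)]]%SET.

Definition matchings (T : finType) (e : rel T) (k : nat) :
    {set {set {set T}}} :=
  [set S : {set {set T}} |
     [&& S \subset edges e, finset.trivIset S & #|S| == k]]%SET.

Definition matching_poly (R : realType) (T : finType) (e : rel T) : {poly R} :=
  \sum_(k < (#|T|./2).+1)
     ((-1) ^+ k * (#|matchings e k|)%:R) *: 'X^(#|T| - 2 * k).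

Definition largest_root (R : realType) (p : {poly R}) (z : R) : Prop :=
  root p z /\ forall w : R, root p w -> w <= z.

(* Main.v *)
(* A point of the standard figure is a cell (c, r) of the double refinement
   M^{x2}, i.e. an edge of its row-column graph, together with the distance of
   the point to the centre of the cell of M. Two points on edges without common
   vertex can exchange their distances without changing the permutation, so the
   gridded permutations of length n correspond to the traces of length n in the
   partially commutative monoid whose letters are the edges, two letters
   commuting iff they are disjoint. A trace is represented by its projections
   on the vertices. A permutation has at most (n+1)^(2t+2u) griddings, so that
   the growth rate of Geom(M) is that of the number T n of traces.

   By Cartier and Foata, sum_n T n z^n is the inverse of
   P(z) = sum_k (-1)^k m_k z^k. As T is submultiplicative, it has an exponential
   rate L with L^n <= T n, whence 0 < P(z) <= 1 - L z for 0 <= z < 1/L, and 1/L is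
   the smallest positive root of P. Finally mu(z) = z^|V| P(z^-2). *)

Require Import Defs.
From mathcomp Require Import all_boot all_order all_algebra all_fingroup.
From mathcomp Require Import all_classical all_reals all_analysis.
From mathcomp Require Import zify ring lra.

Set Implicit Arguments.
Unset Strict Implicit.
Unset Printing Implicit Defensive.

Import Order.TTheory GRing.Theory Num.Theory.
Import numFieldNormedType.Exports.
Local Open Scope ring_scope.

(** * Traces of a partially commutative monoid and the Cartier-Foata identity *)

Section Traces.
Variables (V : finType) (E : {set {set V}}).
Hypothesis E0 : finset.set0 \notin E.

Local Notation trace := {ffun V -> seq {set V}}.

Definition trace_nil : trace := [ffun => [::]].

Definition trace_cons (a : {set V}) (x : trace) : trace :=
  [ffun v => if v \in a then a :: x v else x v].

Definition trace_of (w : seq {set V}) : trace := foldr trace_cons trace_nil w.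

Lemma trace_ofE w v : trace_of w v = [seq a : {set V} <- w | v \in a].
Proof. by elim: w => [|a w IHw] /=; rewrite ffunE // IHw. Qed.

(** Words that differ by commuting disjoint letters give the same function on [V]; [undup] keeps one
    copy of it. *)
Fixpoint traces n : seq trace :=
  if n is m.+1 then
    undup [seq trace_cons a x | a <- enum E, x <- traces m]
  else [:: trace_nil].

Definition num_traces n := size (traces n).

Lemma traces_uniq n : uniq (traces n).
Proof. by case: n => //= n; exact: undup_uniq. Qed.

Lemma tracesP n x :
  reflect (exists w, [/\ size w = n, all (mem E) w & x = trace_of w])
          (x \in traces n).
Proof.
apply: (iffP idP).
  elim: n x => [|n IHn] x /=; first by rewrite inE => /eqP ->; exists [::].
  rewrite mem_undup => /allpairsP[[a y] /= []].
  rewrite mem_enum => aE /IHn[w [<- wE ->]] ->.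
  by exists (a :: w); rewrite /= aE.
case=> w [<- wE ->]; elim: w wE => [|a w IHw] /=; first by rewrite inE.
case/andP=> aE /IHw wE; rewrite mem_undup; apply/allpairsP.
by exists (a, trace_of w); rewrite mem_enum.
Qed.

Lemma trace_of_traces w : all (mem E) w -> trace_of w \in traces (size w).
Proof. by move=> wE; apply/tracesP; exists w. Qed.

(** A nonempty letter can be moved to the front of a word for [x] when it heads the projections on
    all its vertices, see [initialE]. An empty letter would be initial vacuously, whence [E0]. *)
Definition initial (x : trace) (a : {set V}) :=
  [forall v in a, ohead (x v) == Some a].

Lemma initialP (x : trace) (a : {set V}) :
  reflect (forall v, v \in a -> ohead (x v) = Some a) (initial x a).
Proof. by apply: (iffP 'forall_in_eqP). Qed.

Lemma initial_cons a x : initial (trace_cons a x) a.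
Proof. by apply/initialP=> v va; rewrite ffunE va. Qed.

Lemma initial_cons_disjoint (a b : {set V}) (x : trace) :
  [disjoint a & b] -> initial (trace_cons a x) b = initial x b.
Proof.
move=> dab; apply/initialP/initialP=> H v vb; move: (H v vb); rewrite ffunE;
  by rewrite (disjointFl dab vb).
Qed.

Lemma trace_cons_inj a : injective (trace_cons a).
Proof.
move=> x y /ffunP xy; apply/ffunP=> v; move: (xy v); rewrite !ffunE.
by case: ifP => // _ [].
Qed.

Lemma trace_consC (a b : {set V}) (x : trace) : [disjoint a & b] ->
  trace_cons a (trace_cons b x) = trace_cons b (trace_cons a x).
Proof.
move=> dab; apply/ffunP=> v; rewrite !ffunE.
by case: (boolP (v \in a)) => // /(disjointFr dab) ->.
Qed.

Lemma initial_disjoint (x : trace) (a b : {set V}) :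
  initial x a -> initial x b -> a != b -> [disjoint a & b].
Proof.
move=> /initialP xa /initialP xb; apply: contraR => /pred0Pn[v /andP[/= va vb]].
by move: (xa v va); rewrite (xb v vb) => -[->].
Qed.

Lemma initial_inE n x a : x \in traces n -> a != finset.set0 -> initial x a ->
  a \in E.
Proof.
case/tracesP=> w [_ /allP wE ->] /finset.set0Pn[v va] /initialP/(_ v va).
rewrite trace_ofE; case Dw: [seq _ <- _ | _] => [|b s] //= [ba].
apply: wE; have: b \in [seq a0 : {set V} <- w | v \in a0].
  by rewrite Dw mem_head.
by rewrite mem_filter ba => /andP[].
Qed.

(** Induction on a word for [x]. If its first letter [b] differs from [a], the two are disjoint, so
    [a] is still initial in the tail; the tail is rewritten to begin with [a], which then moves past
    [b]. *)
Lemma initialE n x a : x \in traces n.+1 -> a \in E ->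
  initial x a = (x \in [seq trace_cons a y | y <- traces n]).
Proof.
move=> xT aE; apply/idP/idP=> [|/mapP[y _ ->]]; last exact: initial_cons.
case/tracesP: xT => w [].
elim: w n x => [|b w IHw] n x //= [sw] /andP[bE wE] ->.
have [->|ab] := eqVneq a b.
  by move=> _; apply/mapP; exists (trace_of w) => //; rewrite -sw trace_of_traces.
move=> ina; have dba := initial_disjoint (initial_cons b _) ina.
have {}dba := dba (contra_neq esym ab).
rewrite initial_cons_disjoint // in ina.
have [v va] : exists v, v \in a by apply/finset.set0Pn; apply: contraNneq E0 => <-.
case: n sw => [|n] sw.
  by move/initialP/(_ v va): ina; rewrite (size0nil sw) ffunE.
case/mapP: (IHw n _ sw wE erefl ina) => y yT ->.
rewrite trace_consC //; apply: map_f; rewrite /= mem_undup; apply/allpairsP.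
by exists (b, y); rewrite mem_enum.
Qed.

(* The traces in which all letters of [cs] are initial are exactly those
   obtained by putting [cs] in front of a shorter trace. *)
Lemma count_initial (cs : seq {set V}) n :
  uniq cs -> all (mem E) cs -> finset.trivIset [set:: cs]%SET ->
  count (fun x => all (initial x) cs) (traces n) =
  if (size cs <= n)%N then num_traces (n - size cs) else 0%N.
Proof.
elim: cs n => [|a cs IHcs] n.
  by rewrite subn0 -[RHS]count_predT => _ _ _; apply: eq_count.
move=> /= /andP[acs ucs] /andP[aE csE] tI.
have dcs b : b \in cs -> [disjoint a & b].
  move=> bcs; apply: (finset.trivIsetP tI); rewrite ?inE ?eqxx ?bcs ?orbT //.
  by apply: contraNneq acs => ->.
have tcs : finset.trivIset [set:: cs]%SET.
  by apply: trivIsetS tI; apply/fintype.subsetP=> b; rewrite !inE => ->;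
    rewrite orbT.
case: n => [|n].
  rewrite ltn0 /= addn0; suff /negbTE-> : ~~ initial trace_nil a by [].
  have [v va] : exists v, v \in a by apply/finset.set0Pn; apply: contraNneq E0 => <-.
  by apply/negP=> /initialP/(_ v va); rewrite ffunE.
rewrite ltnS subSS -(IHcs n) // -[LHS]/(count (predI (initial^~ a)
  (fun x => all (initial x) cs)) (traces n.+1)) -size_filter.
rewrite [in LHS](eq_filter (a2 := predI (fun x => all (initial x) cs)
  (initial^~ a))); last by move=> x; exact: andbC.
rewrite filter_predI size_filter.
(* Stripping the initial letter [a] is a bijection onto the traces of length [n]; the letters of
   [cs] are disjoint from [a], so their being initial is unaffected. *)
have /seq.permP -> : perm_eq [seq x <- traces n.+1 | initial x a]
                         [seq trace_cons a y | y <- traces n].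
  apply: uniq_perm; first by rewrite filter_uniq ?traces_uniq.
    by rewrite map_inj_uniq ?traces_uniq //; exact: trace_cons_inj.
  move=> x; rewrite mem_filter; case: (boolP (x \in traces n.+1)) => xT.
    by rewrite andbT (initialE xT).
  rewrite andbF; apply/esym/negP=> /mapP[y yT xE]; case/negP: xT.
  rewrite xE /= mem_undup; apply/allpairsP.
  by exists (a, y); rewrite mem_enum.
rewrite count_map; apply: eq_count => x /=; apply: eq_in_all => b bcs.
by rewrite initial_cons_disjoint ?dcs.
Qed.

Definition initials x := [set a in E | initial x a]%SET.

Lemma initials_neq0 n x : x \in traces n.+1 -> initials x != finset.set0.
Proof.
case/tracesP=> -[|a w] [] // _ /andP[aE _] ->.
by apply/finset.set0Pn; exists a; rewrite inE [a \in E]aE initial_cons.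
Qed.

Lemma initials_trivIset x : finset.trivIset (initials x).
Proof.
apply/finset.trivIsetP=> a b; rewrite !inE => /andP[_ xa] /andP[_ xb].
exact: initial_disjoint xa xb.
Qed.

Definition num_matchings k :=
  #|[set C : {set {set V}} | [&& C \subset E, finset.trivIset C & #|C| == k]]%SET|.

(** Toggling a fixed element [a] of [B] pairs the subsets of [B] with opposite signs. *)
Lemma sum_initials (A : nzRingType) (B : {set {set V}}) :
  \sum_(C : {set {set V}} | C \subset B) (-1) ^+ #|C| = (B == finset.set0)%:R :> A.
Proof.
have [->|/finset.set0Pn[a aB]] := eqVneq B finset.set0.
  rewrite (big_pred1 finset.set0) ?cards0 ?expr0 // => C.
  by rewrite finset.subset0.
rewrite (bigID (fun C : {set {set V}} => a \in C)) /=.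
rewrite (reindex_onto (fun C => a |: C)%SET (fun C => C :\ a)%SET) /=; last first.
  by move=> C /andP[_ aC]; rewrite finset.setD1K.
rewrite (eq_bigl (fun C : {set {set V}} => (C \subset B) && (a \notin C))).
  rewrite -big_split big1 //= => C /andP[_ aC].
  by rewrite cardsU1 aC exprS mulN1r addNr.
move=> C; rewrite finset.subUset finset.sub1set aB setU11 andbT /=; congr andb.
by apply/eqP/idP=> [<-|aC]; rewrite ?setD11 // finset.setU1K.
Qed.

(** The coefficient of [z ^+ n] in the Cartier-Foata identity. Pairs of a matching [C] and a trace
    [x] in which all of [C] is initial are counted with sign [(-1) ^+ #|C|]. Grouped by [C] they
    give the left side by [count_initial]; grouped by [x] they cancel by [sum_initials], since only
    the empty trace has no initial letter. *)
Lemma num_traces_rec (A : nzRingType) n :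
  \sum_(k < n.+1) (-1) ^+ k * (num_matchings k)%:R * (num_traces (n - k))%:R
  = (n == 0)%:R :> A.
Proof.
pose mt (C : {set {set V}}) := (C \subset E) && finset.trivIset C.
transitivity (\sum_(C | mt C)
    \sum_(x <- traces n | C \subset initials x) (-1) ^+ #|C| : A).
  transitivity (\sum_(C | mt C && (#|C| < n.+1)%N)
    (-1) ^+ #|C| * (num_traces (n - #|C|))%:R : A).
    rewrite (partition_big
      (fun C : {set {set V}} => inord #|C| : 'I_n.+1) predT) //=.
    apply: eq_bigr => k _; rewrite /num_matchings cardsE -sum1_card natr_sum.
    rewrite mulr_sumr mulr_suml; apply: eq_big => [C|C].
      rewrite unfold_in /mt andbA -[RHS]andbA; congr andb.
      apply/eqP/andP=> [->|[Cn /eqP <-]]; last by rewrite inordK.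
      by rewrite ltn_ord inord_val.
    by rewrite unfold_in => /and3P[_ _ /eqP ->]; rewrite mulr1.
  rewrite big_mkcondr; apply: eq_bigr => C /andP[CE tC].
  rewrite big_const_seq iter_addr_0.
  have -> : count (fun x => C \subset initials x) (traces n)
          = count (fun x => all (initial x) (enum C)) (traces n).
    apply: eq_count => x; apply/fintype.subsetP/allP=> H a.
      by rewrite mem_enum => /H; rewrite inE => /andP[].
    by move=> aC; rewrite inE (fintype.subsetP CE) //= H // mem_enum.
  rewrite count_initial ?enum_uniq -?cardE ?ltnS.
  - by case: ifP => // _; rewrite mulr_natr.
  - by [].
  - by apply/allP=> a; rewrite mem_enum; exact: (fintype.subsetP CE).
  - by congr finset.trivIset: tC; apply/finset.setP=> a; rewrite inE mem_enum.
transitivity (\sum_(x <- traces n)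
    \sum_(C : {set {set V}} | C \subset initials x) (-1) ^+ #|C| : A).
  (* Initial letters are pairwise disjoint, so every set of them is a matching and the inner sum
     runs over all subsets of [initials x]. *)
  rewrite (exchange_big_dep predT) //=; apply: eq_bigr => x _.
  apply: eq_bigl => C; case: (boolP (C \subset _)) => [Cx|]; last by rewrite andbF.
  rewrite andbT.
  rewrite /mt (finset.trivIsetS Cx (initials_trivIset x)) andbT.
  apply: (fintype.subset_trans Cx).
  by apply/fintype.subsetP=> a; rewrite inE => /andP[].
case: n => [|n].
  rewrite big_seq1 sum_initials; congr (nat_of_bool _)%:R; apply/eqP/finset.setP=> a.
  rewrite !inE; apply/negP=> /andP[aE /initialP xa].
  have [v va] : exists v, v \in a by apply/finset.set0Pn; apply: contraNneq E0 => <-.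
  by move: (xa v va); rewrite ffunE.
rewrite big_seq big1 // => x xT; rewrite sum_initials.
by rewrite (negbTE (initials_neq0 xT)).
Qed.

Lemma num_traces0 : num_traces 0 = 1%N.
Proof. by []. Qed.

Definition trace_cat (x y : trace) : trace := [ffun v => x v ++ y v].

(** Cutting a word after [m] letters writes every trace of length [m + n] as a [trace_cat] of one
    trace from each list. *)
Lemma num_tracesD m n : (num_traces (m + n) <= num_traces m * num_traces n)%N.
Proof.
rewrite /num_traces -(size_allpairs trace_cat); apply: uniq_leq_size.
  exact: traces_uniq.
move=> x /tracesP[w [sw wE ->]]; apply/allpairsP.
exists (trace_of (take m w), trace_of (drop m w)); split=> /=.
- apply/tracesP; exists (take m w); split=> //.
    by rewrite size_takel // sw leq_addr.
  by apply/allP=> a /mem_take; exact: (allP wE).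
- apply/tracesP; exists (drop m w); split=> //.
    by rewrite size_drop sw addKn.
  by apply/allP=> a /mem_drop; exact: (allP wE).
- apply/ffunP=> v; rewrite ffunE !trace_ofE -filter_cat cat_take_drop //.
Qed.

Lemma num_traces_gt0 n : E != finset.set0 -> (0 < num_traces n)%N.
Proof.
case/finset.set0Pn=> a aE; rewrite /num_traces.
have := @trace_of_traces (nseq n a); rewrite all_nseq size_nseq /= aE orbT.
by move=> /(_ isT); case: (traces n).
Qed.

End Traces.

Lemma card_pair_matching (V : finType) (C : {set {set V}}) :
  (forall a, a \in C -> #|a| = 2%N) ->
  finset.trivIset C -> (#|C| * 2 <= #|V|)%N.
Proof.
move=> C2 /eqP tC; apply: (leq_trans _ (max_card (mem (finset.cover C)))).
by rewrite -tC (eq_bigr (fun _ => 2%N)) // sum_nat_const.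
Qed.

(** * Submultiplicative sequences and the smallest positive root of the inverse series *)

Section InverseSeries.
Variables (R : realType) (T m : nat -> nat) (K : nat).
Hypothesis T0 : T 0 = 1%N.
Hypothesis T_gt0 : forall n, (0 < T n)%N.
Hypothesis TD : forall n p, (T (n + p) <= T n * T p)%N.
Hypothesis T_rec : forall n,
  \sum_(k < n.+1) (-1) ^+ k * (m k)%:R * (T (n - k))%:R = (n == 0)%:R :> R.
Hypothesis m_small : forall k, (K < k)%N -> m k = 0%N.

Definition alt_poly : {poly R} := \poly_(k < K.+1) ((-1) ^+ k * (m k)%:R).

Lemma horner_alt_poly (z : R) :
  alt_poly.[z] = \sum_(k < K.+1) (-1) ^+ k * (m k)%:R * z ^+ k.
Proof. by rewrite horner_poly. Qed.

(** Fekete's argument: [L] is the supremum of the [x >= 0] with [x ^+ n <= T n] for all [n]. If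
    [r > L], some [n0] has [T n0 < r ^+ n0], and division of [n] by [n0] spreads this to all [n]
    through [TD]. *)
Lemma exists_exp_rate : exists L : R, [/\ 1 <= L,
  forall n, L ^+ n <= (T n)%:R
  & forall r, L < r -> exists C : R, forall n, (T n)%:R <= C * r ^+ n].
Proof.
pose S : set R := [set x | 0 <= x /\ forall n, x ^+ n <= (T n)%:R]%classic.
have S1 : S 1 by split=> // n; rewrite expr1n ler1n.
have Sub x : S x -> x <= (T 1)%:R by move=> [_ /(_ 1%N)]; rewrite expr1.
have Ssup : has_sup S by split; [exists 1 | exists (T 1)%:R => x /Sub].
have Lge x : S x -> x <= sup S by move=> Sx; apply: sup_upper_bound.
exists (sup S); split; first exact: Lge.
- case=> [|n]; first by rewrite expr0 T0.
  pose y : R := (T n.+1)%:R `^ (n.+1%:R)^-1.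
  have yE : y ^+ n.+1 = (T n.+1)%:R.
    by rewrite -powR_mulrn ?powR_ge0 // -powRrM mulVf ?pnatr_eq0 // powRr1.
  have Ly : sup S <= y.
    apply: ge_sup; first by exists 1.
    move=> x [x0 /(_ n.+1)]; rewrite -yE ler_pXn2r // nnegrE //.
    exact: powR_ge0.
  rewrite -yE lerXn2r // ?nnegrE ?powR_ge0 //.
  by apply: le_trans (Lge _ S1); exact: ler01.
- move=> r Lr; have r1 : 1 <= r by rewrite (le_trans (Lge _ S1)) // ltW.
  have r0 : 0 <= r by rewrite (le_trans ler01).
  have /existsNP[n0 /negP] : ~ forall n, r ^+ n <= (T n)%:R.
    by move=> H; have := Lge r (conj r0 H); rewrite leNgt Lr.
  rewrite -ltNge => Tn0.
  have n0_gt0 : (0 < n0)%N by case: n0 Tn0 => //; rewrite expr0 T0 ltxx.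
  (* The constant dominates [T] at every possible remainder of [n] modulo [n0]. *)
  exists (\sum_(s < n0) (T s)%:R) => n.
  have TM q s : (T (q * n0 + s))%:R <= r ^+ (q * n0) * (T s)%:R.
    elim: q => [|q IHq]; first by rewrite mul0n expr0 mul1r.
    rewrite mulSn -addnA exprD -mulrA.
    apply: (le_trans (y := (T n0 * T (q * n0 + s))%:R)); first by rewrite ler_nat.
    by rewrite natrM ler_pM // ltW.
  rewrite {1}(divn_eq n n0) (le_trans (TM _ _)) // mulrC ler_pM //.
  + by rewrite exprn_ge0.
  + rewrite (bigD1 (Ordinal (ltn_pmod n n0_gt0))) //= lerDl sumr_ge0 //.
  + by rewrite ler_weXn2l // leq_divM.
Qed.

(** The product of the two series is cut at total degree [N]: each [k] gets its own partial sum, so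
    the identity is exact and leaves no remainder to estimate. *)
Lemma truncated_inverse (z : R) N :
  \sum_(k < K.+1) (-1) ^+ k * (m k)%:R * z ^+ k *
     (\sum_(0 <= j < N.+1 - k) (T j)%:R * z ^+ j) = 1.
Proof.
pose F N' := \sum_(k < K.+1) (-1) ^+ k * (m k)%:R * z ^+ k *
     (\sum_(0 <= j < N' - k) (T j)%:R * z ^+ j).
rewrite -/(F N.+1); have FS n : F n.+1 = F n + (n == 0)%:R.
  apply/eqP; rewrite addrC -subr_eq; apply/eqP; rewrite /F -sumrB.
  transitivity (\sum_(k < K.+1 | (k < n.+1)%N)
      (-1) ^+ k * (m k)%:R * (T (n - k))%:R * z ^+ n).
    rewrite [RHS]big_mkcond; apply: eq_bigr => k _; rewrite -mulrBr ltnS.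
    case: leqP => kn.
      rewrite subSn // big_nat_recr //= addrAC subrr add0r.
      by rewrite -[in z ^+ n](subnK kn) exprD; ring.
    have /eqP-> : (n.+1 - k == 0)%N by rewrite subn_eq0.
    have /eqP-> : (n - k == 0)%N by rewrite subn_eq0 ltnW.
    by rewrite subrr mulr0.
  have -> : \sum_(k < K.+1 | (k < n.+1)%N)
      (-1) ^+ k * (m k)%:R * (T (n - k))%:R * z ^+ n =
     \sum_(k < n.+1) (-1) ^+ k * (m k)%:R * (T (n - k))%:R * z ^+ n.
    pose f k := (-1) ^+ k * (m k)%:R * (T (n - k))%:R * z ^+ n.
    rewrite (big_ord_widen_cond (K + n).+1 (fun k => k < n.+1)%N f); last first.
      by rewrite ltnS leq_addr.
    rewrite [RHS](big_ord_widen (K + n).+1 f) ?ltnS ?leq_addl //.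
    rewrite big_mkcondr; apply: eq_bigr => k _ /=.
    by case: ltnP => // Kk; rewrite /f m_small // mulr0 !mul0r.
  rewrite -mulr_suml T_rec; case: n => [|n]; last by rewrite mul0r.
  by rewrite expr0 mulr1.
elim: N => [|N IHN]; rewrite FS ?IHN ?addr0 //.
by rewrite /F big1 ?add0r // => k _; rewrite sub0n big_nil mulr0.
Qed.

(** The value at [z] is the inverse of the series with terms [T j * z ^+ j], which dominates the
    geometric series of [L * z]. *)
Lemma alt_poly_bounds (L z : R) :
  1 <= L -> (forall n, L ^+ n <= (T n)%:R) ->
  (forall r, L < r -> exists C : R, forall n, (T n)%:R <= C * r ^+ n) ->
  0 <= z -> z < L^-1 -> 0 < alt_poly.[z] <= 1 - L * z.
Proof.
move=> L1 LT rT z0 zL; have L0 : 0 < L by apply: lt_le_trans L1.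
have Lz1 : L * z < 1 by rewrite mulrC -ltr_pdivlMr // mul1r.
have Lz0 : 0 <= L * z by rewrite mulr_ge0 // ltW.
pose u : R^nat := fun j => (T j)%:R * z ^+ j.
have u0 j : 0 <= u j by rewrite mulr_ge0 ?exprn_ge0.
have cu : cvgn (series u).
  have d0 : 0 < (1 - L * z) / (z + 1) by rewrite divr_gt0 ?subr_gt0 // ltr_wpDl.
  (* A base above [L] with [r * z < 1]; dividing by [z + 1] rather than [z] covers [z = 0]. *)
  pose r := L + (1 - L * z) / (z + 1).
  have [|C TC] := rT r; first by rewrite ltrDl.
  have r0 : 0 <= r by rewrite addr_ge0 // ltW.
  have rz1 : r * z < 1.
    have -> : r * z = 1 - (1 - L * z) / (z + 1).
      by rewrite /r; field; rewrite gt_eqF // ltr_wpDl.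
    by rewrite ltrBlDr ltrDl.
  apply: (@series_le_cvg _ _ (geometric C (r * z))) => //.
  - move=> j; rewrite /geometric /= mulr_ge0 ?exprn_ge0 //; last exact: mulr_ge0.
    by have := TC 0%N; rewrite expr0 mulr1; apply: le_trans.
  - by move=> j; rewrite /geometric /= exprMn mulrA ler_wpM2r ?exprn_ge0.
  - by apply: is_cvg_geometric_series; rewrite ger0_norm // mulr_ge0.
pose S := limn (series u).
have PS : alt_poly.[z] * S = 1.
  rewrite horner_alt_poly mulr_suml.
  (* [truncated_inverse] passes to the limit term by term, each partial sum tending to [S]; starting
     at [N + K.+1] keeps the subtraction of [k] from being truncated. *)
  have lhs : (\sum_(k < K.+1) (-1) ^+ k * (m k)%:R * z ^+ k *
     series u (N + K.+1 - k)%N @[N --> \oo] -->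
     \sum_(k < K.+1) (-1) ^+ k * (m k)%:R * z ^+ k * S)%classic.
    apply: cvg_big => [|k _]; first exact: add_continuous.
    apply: cvgM; first exact: cvg_cst.
    rewrite (_ : (fun N => _) = (fun N => series u (N + (K.+1 - k))%N)).
      by rewrite (cvg_shiftn (K.+1 - k) (series u)).
    by apply/funext=> N; rewrite addnBA // ltnW.
  move: lhs; rewrite (_ : (fun N => _) = (fun=> 1)) => [lhs|].
    apply: (cvg_unique _ lhs); last exact: cvg_cst.
    exact: Rhausdorff.
  apply/funext=> N; rewrite -[RHS](truncated_inverse z (N + K)) addnS.
  by apply: eq_bigr => k _; rewrite /series /=.
have SL : (1 - L * z)^-1 <= S.
  have cg : (series (geometric 1 (L * z)) @ \oo --> (1 - L * z)^-1)%classic.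
    rewrite -[(1 - L * z)^-1]mul1r.
    by apply: cvg_geometric_series; rewrite ger0_norm.
  rewrite -(cvg_lim (@Rhausdorff R) cg); apply: ler_lim => //.
    by apply/cvg_ex; exists (1 - L * z)^-1.
  apply: nearW => N; apply: ler_sum => j _.
  by rewrite /geometric /u /= mul1r exprMn ler_wpM2r ?exprn_ge0.
have S0 : 0 < S by apply: lt_le_trans SL; rewrite invr_gt0 subr_gt0.
have -> : alt_poly.[z] = S^-1.
  by apply: (mulIf (lt0r_neq0 S0)); rewrite PS mulVf // gt_eqF.
by rewrite invr_gt0 S0 -[leRHS]invrK lef_pV2 // posrE invr_gt0 subr_gt0.
Qed.

(** The bounds on [alt_poly] squeeze it to 0 at [L^-1]; the intermediate value theorem stands in for
    the limit. *)
Lemma alt_poly_smallest_root : exists L : R, [/\ 1 <= L,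
  forall n, L ^+ n <= (T n)%:R,
  forall r, L < r -> exists C : R, forall n, (T n)%:R <= C * r ^+ n,
  root alt_poly L^-1
  & forall z, 0 <= z -> z < L^-1 -> 0 < alt_poly.[z]].
Proof.
have [L [L1 LT rT]] := exists_exp_rate; exists L.
have bnd := alt_poly_bounds L1 LT rT.
split=> //; last by move=> z z0 zL; case/andP: (bnd z z0 zL).
have L0 : 0 < L by apply: lt_le_trans L1.
have iL0 : 0 <= L^-1 by rewrite invr_ge0 ltW.
have P0 := bnd 0 (lexx 0); rewrite invr_gt0 L0 in P0.
have {}P0 := P0 isT.
set p := alt_poly in bnd P0 *; rewrite rootE; apply: contraT => pL.
have [pneg|ppos|pz] := ltrgt0P p.[L^-1]; last by rewrite pz eqxx in pL.
(* Positive value at [L^-1]: somewhere on the interval [p] would exceed [1 - L * x] by half that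
   value, against the upper bound. *)
- pose q := p - (1 - L *: 'X) - (p.[L^-1] / 2)%:P.
  have qE x : q.[x] = p.[x] - (1 - L * x) - p.[L^-1] / 2 by rewrite /q !hornerE.
  have [|x /andP[x0 xL] /rootP] := @poly_ivt R q 0 L^-1 iL0.
    have LL : L * L^-1 = 1 by rewrite divff // gt_eqF.
    rewrite !qE LL mulr0; apply/andP; split; last by lra.
    by case/andP: P0; lra.
  rewrite qE; move: xL; rewrite le_eqVlt => /predU1P[->|xL].
    by rewrite divff ?gt_eqF //; lra.
  by case/andP: (bnd x x0 xL); lra.
(* Negative value at [L^-1]: somewhere [p] would take half that value, against positivity. *)
- pose q := (p.[L^-1] / 2)%:P - p.
  have qE x : q.[x] = p.[L^-1] / 2 - p.[x] by rewrite /q !hornerE.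
  have [|x /andP[x0 xL] /rootP] := @poly_ivt R q 0 L^-1 iL0.
    by rewrite !qE; apply/andP; split; [case/andP: P0|]; lra.
  rewrite qE; move: xL; rewrite le_eqVlt => /predU1P[->|xL]; first by lra.
  by case/andP: (bnd x x0 xL); lra.
Qed.

End InverseSeries.

(** * The matching polynomial and its largest root *)

Section MatchingPolynomial.
Variables (R : realType) (V : finType) (e : rel V).
Hypothesis e_irr : irreflexive e.

Lemma card_edge a : a \in edges e -> #|a| = 2%N.
Proof.
rewrite inE => /existsP[v /existsP[w /andP[vw /eqP ->]]].
by rewrite cards2; case: eqVneq vw => // ->; rewrite e_irr.
Qed.

Lemma set0_edges : finset.set0 \notin edges e.
Proof. by apply/negP=> /card_edge; rewrite cards0. Qed.

Lemma num_matchings_small k :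
  (#|V|./2 < k)%N -> num_matchings (edges e) k = 0%N.
Proof.
move=> Vk; apply/eqP; rewrite cards_eq0; apply/eqP/finset.setP=> C; rewrite !inE.
apply/negP=> /and3P[CE tC /eqP Ck].
have : (#|C| * 2 <= #|V|)%N.
  by apply: card_pair_matching tC => a /(fintype.subsetP CE)/card_edge.
rewrite Ck muln2 leqNgt -[X in (X < _)%N]odd_double_half.
by move: Vk; case: odd; lia.
Qed.

Lemma horner_matching_poly (w : R) : w != 0 ->
  (matching_poly R e).[w] = w ^+ #|V| *
    (alt_poly R (num_matchings (edges e)) #|V|./2).[w ^- 2].
Proof.
move=> w0; rewrite /matching_poly horner_sum horner_alt_poly mulr_sumr.
apply: eq_bigr => k _; rewrite hornerZ hornerXn mulrCA; congr (_ * _).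
have k2 : (2 * k <= #|V|)%N.
  by rewrite -[X in (_ <= X)%N]odd_double_half; have := ltn_ord k; lia.
have -> : w ^+ #|V| = w ^+ (#|V| - 2 * k) * w ^+ (2 * k) by rewrite -exprD subnK.
rewrite -mulrA -exprVn -exprM.
by rewrite -exprMn divff // expr1n mulr1.
Qed.

(** A root [w] above the square root of [L] would give [w ^- 2 < L^-1], where [alt_poly] is
    positive. *)
Lemma matching_growth_rate : edges e != finset.set0 ->
  exists L : R, [/\ 1 <= L,
    forall n, L ^+ n <= (num_traces (edges e) n)%:R,
    forall r, L < r ->
      exists C : R, forall n, (num_traces (edges e) n)%:R <= C * r ^+ n
    & largest_root (matching_poly R e) (Num.sqrt L)].
Proof.
move=> En0; have := @alt_poly_smallest_root R (num_traces (edges e))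
  (num_matchings (edges e)) #|V|./2 (num_traces0 _)
  (fun n => num_traces_gt0 n En0) (num_tracesD _)
  (num_traces_rec set0_edges R) num_matchings_small.
case=> L [L1 LT rT rootL posP]; exists L; split=> //.
have L0 : 0 < L by apply: lt_le_trans L1.
have sL0 : 0 < Num.sqrt L by rewrite sqrtr_gt0.
split.
  rewrite rootE horner_matching_poly ?lt0r_neq0 // sqr_sqrtr ?ltW //.
  by rewrite (rootP rootL) mulr0.
move=> w /rootP rw; rewrite leNgt; apply/negP=> Lw.
have w0 : 0 < w by apply: lt_trans Lw.
move: rw; rewrite horner_matching_poly ?lt0r_neq0 //; apply/eqP; rewrite gt_eqF //.
rewrite mulr_gt0 ?exprn_gt0 // posP ?invr_ge0 ?exprn_ge0 ?ltW //.
rewrite ltf_pV2 ?posrE ?exprn_gt0 // -[L]sqr_sqrtr ?ltW //.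
by rewrite ltr_pXn2r // nnegrE ltW.
Qed.

End MatchingPolynomial.

(** * Gridded permutations and their traces *)

Section GriddedPermutations.
Variables (p q : nat).
Local Notation V := ('I_p + 'I_q)%type.

Definition edge (x : 'I_p * 'I_q) : {set V} := [set inl x.1; inr x.2]%SET.

Lemma mem_edge_inl c x : (inl c \in edge x) = (x.1 == c).
Proof. by rewrite !inE orbF eq_sym. Qed.

Lemma mem_edge_inr r x : (inr r \in edge x) = (x.2 == r).
Proof. by rewrite !inE /= eq_sym. Qed.

Lemma edge_inj : injective edge.
Proof.
move=> [c r] [c' r'] /finset.setP ee; congr pair.
  by have := ee (inl c'); rewrite !mem_edge_inl eqxx => /eqP.
by have := ee (inr r'); rewrite !mem_edge_inr eqxx => /eqP.
Qed.

Variable n : nat.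
Implicit Types (s : 'S_n) (k l a b : 'I_n).

Definition orient (T : Type) (b : bool) (z : seq T) := if b then z else rev z.

Lemma orient_inj (T : Type) (b : bool) : injective (@orient T b).
Proof. by case: b => // x y; apply: (can_inj revK). Qed.

Lemma map_orient (T U : Type) (f : T -> U) (b : bool) z :
  orient b (map f z) = map f (orient b z).
Proof. by case: b; rewrite //= map_rev. Qed.

(* Points of an odd line (the second half of a cell of M) appear in the order
   of their distances to the centre of the cell, those of an even line in the
   reverse order. *)
Definition gridded_trace s (cF : 'I_n -> 'I_p) (rF : 'I_n -> 'I_q) :
    {ffun V -> seq {set V}} :=
  [ffun v : V => map edge
    match v with
    | inl c => orient (odd c)
        [seq (cF a, rF (s a)) | a <- [seq a <- enum 'I_n | cF a == c]]
    | inr r => orient (odd r)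
        [seq (cF ((s^-1)%g b), rF b) | b <- [seq b <- enum 'I_n | rF b == r]]
    end].

(** Points are numbered by increasing distance from the centre of their cell of [M], and [f] gives
    their line. This is their geometric order, which on even lines reverses the numbering. *)
Definition line_lt (f : 'I_n -> nat) k l :=
  (f k < f l)%N || (f k == f l) && (if odd (f k) then (k < l)%N else (l < k)%N).

(** [sg] sends a position to the number of the point there. With [sg] for the columns and [sg'] for
    the rows, the permutation drawn is [sg * sg'^-1], products being read from left to right. *)
Definition line_order (f : 'I_n -> nat) (sg : 'S_n) :=
  forall a b, (a < b)%N -> line_lt f (sg a) (sg b).

Lemma ord_ltn_sorted : sorted (fun k l : 'I_n => (k < l)%N) (enum 'I_n).
Proof.
by have := iota_ltn_sorted 0 n; rewrite -val_enum_ord sorted_map.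
Qed.

(** Within one line, positions follow the numbering or its reverse, and [orient] undoes the
    reversal; two increasing lists with the same elements then coincide. *)
Lemma orient_line (f : 'I_n -> nat) sg (x : nat) : line_order f sg ->
  orient (odd x) [seq sg a | a <- [seq a <- enum 'I_n | f (sg a) == x]] =
  [seq k <- enum 'I_n | f k == x].
Proof.
move=> fsg; pose lt (k l : 'I_n) := (k < l)%N.
have lt_tr : transitive lt by move=> k l j; exact: ltn_trans.
apply: (irr_sorted_eq (leT := lt)) => //.
- by move=> k; rewrite /lt ltnn.
- suff : sorted (fun k l => if odd x then lt k l else lt l k)
      [seq sg a | a <- [seq a <- enum 'I_n | f (sg a) == x]].
    by rewrite /orient; case: (odd x); rewrite // rev_sorted.
  rewrite sorted_map.
  apply: (sub_in_sorted (P := fun a => f (sg a) == x) (e := lt)).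
  + move=> a b; rewrite !unfold_in => /eqP fa /eqP fb /fsg.
    by rewrite /line_lt fa fb ltnn eqxx.
  + by apply/allP=> a; rewrite mem_filter => /andP[].
  + by apply: sorted_filter => //; exact: ord_ltn_sorted.
- by apply: sorted_filter => //; exact: ord_ltn_sorted.
move=> k; rewrite mem_filter mem_enum andbT.
rewrite /orient; have -> : (k \in (if odd x then
    [seq sg a | a <- enum 'I_n & f (sg a) == x]
    else rev [seq sg a | a <- enum 'I_n & f (sg a) == x])) =
    (k \in [seq sg a | a <- enum 'I_n & f (sg a) == x]).
  by case: (odd x); rewrite // mem_rev.
apply/idP/idP=> [/mapP [a + ->] | fk].
  by rewrite mem_filter => /andP[].
apply/mapP; exists ((sg^-1)%g k); last by rewrite permKV.
by rewrite mem_filter mem_enum permKV fk.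
Qed.

(** The word lists all points by distance, while the right side knows only the gridded permutation:
    how the distances on disjoint edges compare leaves no mark. *)
Lemma trace_of_word (col : 'I_n -> 'I_p) (row : 'I_n -> 'I_q) sg sg' :
  line_order col sg -> line_order row sg' ->
  trace_of [seq edge (col k, row k) | k <- enum 'I_n] =
  gridded_trace (sg * sg'^-1)%g (col \o sg) (row \o sg').
Proof.
move=> csg rsg; apply/ffunP=> v; rewrite trace_ofE ffunE filter_map.
rewrite (map_comp edge (fun k => (col k, row k))); congr map; case: v => [c|r].
  rewrite (eq_filter (a2 := fun k => col k == c)); last first.
    by move=> k /=; rewrite mem_edge_inl.
  rewrite -[in LHS](orient_line c csg) -map_orient; congr orient.
  rewrite -map_comp; apply: eq_map => a /=.
  by rewrite permM permKV.
rewrite (eq_filter (a2 := fun k => row k == r)); last first.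
  by move=> k /=; rewrite mem_edge_inr.
rewrite -[in LHS](orient_line r rsg) -map_orient; congr orient.
rewrite -map_comp; apply: eq_map => b /=.
by rewrite invMg invgK permM permKV.
Qed.

(** Both heads have the least key, so they head the same fibre and are equal; then the tails are
    compared. *)
Lemma sorted_filter_inj (T : eqType) (key : T -> nat) (s1 s2 : seq T) :
  sorted (relpre key leq) s1 -> sorted (relpre key leq) s2 ->
  (forall x, [seq y <- s1 | key y == key x] = [seq y <- s2 | key y == key x]) ->
  s1 = s2.
Proof.
have tr : transitive (relpre key leq) by move=> x y z; exact: leq_trans.
have min x z : sorted (relpre key leq) (x :: z) ->
    forall y, y \in x :: z -> (key x <= key y)%N.
  by move=> /(order_path_min tr)/allP xz y; rewrite inE => /predU1P[->|/xz].
elim: s1 s2 => [|x s1 IH] [|y s2] //.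
- by move=> _ _ /(_ y) /=; rewrite eqxx.
- by move=> _ _ /(_ x) /=; rewrite eqxx.
move=> xs1 ys2 H; have xy : key x = key y.
  apply/eqP; rewrite eqn_leq; apply/andP; split.
    apply: (min x s1 xs1).
    have : y \in [seq z <- y :: s2 | key z == key y].
      by rewrite mem_filter eqxx mem_head.
    by rewrite -H mem_filter => /andP[].
  apply: (min y s2 ys2).
  have : x \in [seq z <- x :: s1 | key z == key x].
    by rewrite mem_filter eqxx mem_head.
  by rewrite H mem_filter => /andP[].
have xy' : x = y by have /= := H x; rewrite -xy eqxx => -[].
rewrite {}xy' in xs1 H xy *; congr cons; apply: IH.
- exact: path_sorted xs1.
- exact: path_sorted ys2.
- by move=> z; have /= := H z; case: ifP => // _ [].
Qed.

Definition line_mono m (f : 'I_n -> 'I_m) :=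
  forall a b, (a < b)%N -> (f a <= f b)%N.

Lemma line_order_mono m (f : 'I_n -> 'I_m) sg : line_order f sg ->
  line_mono (f \o sg).
Proof.
move=> fsg a b /fsg; rewrite /line_lt => /orP[/ltnW //|/andP[/eqP -> _]].
exact: leqnn.
Qed.

Lemma line_mono_sorted m (T : Type) (f : 'I_n -> 'I_m) (g : 'I_n -> T)
    (key : T -> nat) :
  line_mono f -> (forall a, key (g a) = f a) ->
  sorted (relpre key leq) [seq g a | a <- enum 'I_n].
Proof.
move=> fm kg; rewrite sorted_map; apply: sub_sorted ord_ltn_sorted => a b /=.
by rewrite !kg; exact: fm.
Qed.

(** The points of one cell lie on one segment, which is increasing when the parities agree. [cF] is
    indexed by position and [rF] by height, hence [rF (s a)]. *)
Definition cell_mono s (cF : 'I_n -> 'I_p) (rF : 'I_n -> 'I_q) :=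
  forall a b, (a < b)%N -> cF a = cF b -> rF (s a) = rF (s b) ->
  (s a < s b)%N = (odd (cF a) == odd (rF (s a))).

Lemma line_order_cell_mono (col : 'I_n -> 'I_p) (row : 'I_n -> 'I_q) sg sg' :
  line_order col sg -> line_order row sg' ->
  cell_mono (sg * sg'^-1)%g (col \o sg) (row \o sg').
Proof.
move=> csg rsg a b ab /= cab; rewrite !permM !permKV => rab.
have := csg a b ab; rewrite /line_lt cab ltnn eqxx /=.
set a' := (sg'^-1)%g (sg a); set b' := (sg'^-1)%g (sg b).
have a'E : sg' a' = sg a by rewrite permKV.
have b'E : sg' b' = sg b by rewrite permKV.
case: (ltngtP a' b') => [a'b'|b'a'|/val_inj a'b'].
- have := rsg _ _ a'b'; rewrite /line_lt a'E b'E rab ltnn eqxx /=.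
  by case: odd; case: odd => //; case: ltngtP.
- have := rsg _ _ b'a'; rewrite /line_lt a'E b'E rab ltnn eqxx /=.
  by case: odd; case: odd => //; case: ltngtP.
- have sab := etrans (esym a'E) (etrans (congr1 _ a'b') b'E).
  by move: ab; rewrite (perm_inj sab) ltnn.
Qed.

(** Strong induction: with all smaller indices fixed, neither [s k] nor the preimage [l] of [k] lies
    below [k]; and [k < l] together with [k < s k] contradicts monotonicity on the class of [k]. *)
Lemma colour_perm_id (T : eqType) (c : 'I_n -> T) s :
  (forall k, c (s k) = c k) ->
  (forall k l, (k < l)%N -> c k = c l -> (s k < s l)%N) -> s = 1%g.
Proof.
move=> cs cm; apply/permP=> k; rewrite perm1.
have [N] := ubnP (k : nat); elim: N k => // N IH k; rewrite ltnS => kN.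
have fixlt l : (l < k)%N -> s l = l by move=> lk; apply: IH; exact: leq_trans kN.
apply: val_inj; case: (ltngtP (s k) k) => // [sk|ks].
  by have := perm_inj (fixlt _ sk) => skk; rewrite skk ltnn in sk.
pose l := (s^-1)%g k; have sl : s l = k by rewrite permKV.
case: (ltngtP l k) => [lk|kl|/val_inj lk].
- by have := fixlt _ lk; rewrite sl => lkE; rewrite -lkE ltnn in lk.
- have := cm k l kl; rewrite sl -[c l]cs sl => /(_ erefl).
  by rewrite ltnNge ltnW.
- by rewrite -[in X in (_ < X)%N]lk sl ltnn in ks.
Qed.

(** The trace lists the cells of the points of each line and the griddings are monotone, so by
    [sorted_filter_inj] it fixes the cell of every position and of every height. Then [s^-1 * s']
    keeps each height in its cell, and inside a cell both permutations run in the same direction, so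
    [colour_perm_id] applies. *)
Lemma gridded_trace_inj s s' (cF cF' : 'I_n -> 'I_p) (rF rF' : 'I_n -> 'I_q) :
  line_mono cF -> line_mono cF' -> line_mono rF -> line_mono rF' ->
  cell_mono s cF rF -> cell_mono s' cF' rF' ->
  gridded_trace s cF rF = gridded_trace s' cF' rF' -> s = s'.
Proof.
move=> cFm cFm' rFm rFm' sm sm' /ffunP ss'.
have filt m (z z' : 'I_n -> 'I_p * 'I_q) (f f' : 'I_n -> 'I_m)
    (key : 'I_p * 'I_q -> 'I_m) :
    line_mono f -> line_mono f' ->
    (forall a, key (z a) = f a) -> (forall a, key (z' a) = f' a) ->
    (forall x, [seq z a | a <- [seq a <- enum 'I_n | f a == x]] =
          [seq z' a | a <- [seq a <- enum 'I_n | f' a == x]]) -> z =1 z'.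
  move=> fm fm' kz kz' H.
  suff /eq_in_map zz : map z (enum 'I_n) = map z' (enum 'I_n).
    by move=> a; apply: zz; rewrite mem_enum.
  apply: (@sorted_filter_inj _ (fun y => key y : nat)).
  - by apply: (line_mono_sorted (f := f)) => // a; rewrite kz.
  - by apply: (line_mono_sorted (f := f')) => // a; rewrite kz'.
  move=> x; rewrite filter_map [in RHS]filter_map.
  rewrite -(eq_filter (a1 := fun a => f a == key x)).
    rewrite -[in RHS](eq_filter (a1 := fun a => f' a == key x)) //.
    by move=> a /=; rewrite kz'.
  by move=> a /=; rewrite kz.
have colE : (fun a => (cF a, rF (s a))) =1 (fun a => (cF' a, rF' (s' a))).
  apply: (filt _ _ _ cF cF' fst) => // c.
  have := ss' (inl c); rewrite !ffunE => /(inj_map edge_inj).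
  exact: orient_inj.
have rowE : (fun b => (cF ((s^-1)%g b), rF b)) =1
            (fun b => (cF' ((s'^-1)%g b), rF' b)).
  apply: (filt _ _ _ rF rF' snd) => // r.
  have := ss' (inr r); rewrite !ffunE => /(inj_map edge_inj).
  exact: orient_inj.
suff : (s^-1 * s')%g = 1%g by move/(canRL (mulKVg _)); rewrite mulg1.
apply: (colour_perm_id (c := fun b => (cF ((s^-1)%g b), rF b))).
  by move=> b; rewrite permM [LHS]rowE permK -[LHS]colE permKV.
move=> b b' bb' [cE rE]; rewrite !permM.
set a := (s^-1)%g b; set a' := (s^-1)%g b'.
have sa : s a = b by rewrite permKV.
have sa' : s a' = b' by rewrite permKV.
have [ca ra] := colE a; have [ca' ra'] := colE a'.
case: (ltngtP a a') => [aa'|a'a|/val_inj aa'].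
- have := sm a a' aa' cE; rewrite sa sa' => /(_ rE); rewrite bb' => H.
  by rewrite (sm' a a' aa') -?ca -?ca' -?ra -?ra' ?sa ?sa'.
- have := sm a' a a'a (esym cE); rewrite sa sa' => /(_ (esym rE)).
  rewrite ltnNge (ltnW bb') /= => H.
  have := sm' a' a a'a; rewrite -?ca -?ca' -?ra -?ra' ?sa ?sa'.
  move=> /(_ (esym cE) (esym rE)); rewrite -H => /negbT.
  rewrite -leqNgt leq_eqVlt => /orP[/eqP/val_inj/perm_inj aE|//].
  by rewrite aE ltnn in a'a.
- by move: bb'; rewrite -sa -sa' aa' ltnn.
Qed.

End GriddedPermutations.

(** * Points of the standard figure as cells of the double refinement with a distance *)

Section Figure.
Variables (R : realType) (t u : nat) (M : 'M[int]_(t, u)).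
Hypothesis M01 : zpm1_matrix M.

(** The coordinate of a point in line [c] of the refinement, [d] being its distance, along either
    axis, from the centre of its cell of [M]. *)
Definition refined_coord (c : nat) (d : R) : R :=
  (c./2)%:R + 2^-1 + (if odd c then d else - d).

Lemma double_refinementP (c : 'I_t.*2) (r : 'I_u.*2) :
  double_refinement M c r != 0 <->
  M (half_ord c) (half_ord r) = (-1) ^+ (odd c != odd r).
Proof.
rewrite mxE; have := M01 (half_ord c) (half_ord r); rewrite !inE.
by case/or3P=> /eqP ->; case: (odd c); case: (odd r).
Qed.

Lemma cell_segmentP (i j : nat) (x y : R) (b : bool) :
  cell_segment i j ((-1) ^+ b) (x, y) <->
  exists h : R, [/\ 0 < h < 1, x = i%:R + h & y = j%:R + (if b then 1 - h else h)].
Proof.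
rewrite /cell_segment; case: b => /=; rewrite ?expr0 ?expr1 /=.
  split=> [[h /= h01 [<- <-]]|[h [h01 -> ->]]].
    by exists h; split=> //; rewrite -?natr1; ring.
  by exists h => //=; congr pair; rewrite -?natr1; ring.
split=> [[h /= h01 [<- <-]]|[h [h01 -> ->]]].
  by exists h; split=> //; rewrite -?natr1; ring.
by exists h => //=; congr pair; rewrite -?natr1; ring.
Qed.

Lemma standard_figureP (x y : R) : standard_figure M (x, y) <->
  exists c r d, [/\ double_refinement M c r != 0, 0 <= d < 2^-1,
    x = refined_coord c d & y = refined_coord r d].
Proof.
split=> [[i [j]]|[c [r [d [/double_refinementP Mcr d12 -> ->]]]]].
  have [[b Mij]|->] : (exists b : bool, M i j = (-1) ^+ b) \/ M i j = 0.
    have := M01 i j; rewrite !inE => /or3P[]/eqP ->; [by right|left..].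
      by exists false; rewrite expr0.
    by exists true; rewrite expr1.
  2: by rewrite /cell_segment.
    rewrite Mij => /cell_segmentP[h [/andP[h0 h1] -> ->]].
  (* [bc] says that the point is in the second half of its column, the centre [h = 2^-1] included;
     an entry -1 flips the half taken in the row. *)
  pose bc := 2^-1 <= h.
  have ct : (bc + i.*2 < t.*2)%N by have := ltn_ord i; case: bc; lia.
  have ru : ((bc (+) b) + j.*2 < u.*2)%N.
    by have := ltn_ord j; case: (bc (+) b); lia.
  exists (Ordinal ct), (Ordinal ru), (if bc then h - 2^-1 else 2^-1 - h).
  rewrite /refined_coord /= !half_bit_double !oddD !odd_double !addbF !oddb.
  split.
  - apply/double_refinementP; rewrite /= !oddD !odd_double !addbF !oddb.
    have -> : half_ord (Ordinal ct) = i by apply/val_inj; rewrite /= half_bit_double.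
    have -> : half_ord (Ordinal ru) = j by apply/val_inj; rewrite /= half_bit_double.
    by rewrite Mij; case: bc {ct ru}; case: (b).
  - rewrite /bc; case: (lerP 2^-1 h) => hh; apply/andP; split; lra.
  - by case: (bc) => /=; field.
  - by case: (bc); case: (b) => /=; field.
exists (half_ord c), (half_ord r); rewrite Mcr; apply/cell_segmentP => /=.
exists (2^-1 + (if odd c then d else - d)); rewrite /refined_coord addrA; split=> //.
  by case: (odd c); apply/andP; split; lra.
by rewrite -addrA; congr (_ + _); case: (odd c); case: (odd r) => /=; field.
Qed.

Lemma ltr_refined_coord c c' (d d' : R) : 0 <= d < 2^-1 -> 0 <= d' < 2^-1 ->
  refined_coord c d < refined_coord c' d' ->
  (c < c')%N || (c == c') && (if odd c then d < d' else d' < d).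
Proof.
move=> d12 d12'; rewrite /refined_coord.
case: (ltngtP c c') => [//|c'c|<-]; last by case: ifP => _ /=; lra.
have [ch|] := ltnP c'./2 c./2.
  have : c'./2%:R + 1 <= c./2%:R :> R by rewrite natr1 ler_nat.
  by case: (odd c); case: (odd c'); lra.
move=> ch; have -> : c./2 = c'./2 by lia.
have -> : odd c' = false by lia.
have -> : odd c = true by lia.
by lra.
Qed.

(** Distance 0 is excluded here: the two halves of a cell meet at its centre. *)
Lemma refined_coord_lt c c' (d d' : R) : 0 < d < 2^-1 -> 0 < d' < 2^-1 ->
  (c < c')%N || (c == c') && (if odd c then d < d' else d' < d) ->
  refined_coord c d < refined_coord c' d'.
Proof.
move=> d12 d12'; case/orP=> [cc'|/andP[/eqP <-]]; last first.
  by rewrite /refined_coord; case: ifP => _; lra.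
rewrite /refined_coord.
have [ch|] := ltnP c./2 c'./2.
  have : c./2%:R + 1 <= c'./2%:R :> R by rewrite natr1 ler_nat.
  by case: (odd c); case: (odd c'); lra.
move=> ch; have -> : c./2 = c'./2 by lia.
have -> : odd c = false by lia.
have -> : odd c' = true by lia.
by lra.
Qed.

Lemma rank_perm n (f : 'I_n -> R) :
  exists q : 'S_n, forall a b, (q a < q b)%N -> f a <= f b.
Proof.
pose lt a b := (f a < f b) || (f a == f b) && (a < b)%N.
have lt_irr a : lt a a = false by rewrite /lt ltxx ltnn andbF.
have lt_tr : transitive lt.
  move=> b a c /orP[ab|/andP[/eqP ab ab']] /orP[bc|/andP[/eqP bc bc']].
  - by rewrite /lt (lt_trans ab bc).
  - by rewrite /lt -bc ab.
  - by rewrite /lt ab bc.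
  - by rewrite /lt ab bc eqxx (ltn_trans ab' bc') orbT.
have lt_tot a b : [|| lt a b, a == b | lt b a].
  rewrite /lt -(inj_eq val_inj) /=.
  by case: (ltrgtP (f a) (f b)); case: (ltngtP a b).
pose below a := [set b | lt b a]%SET.
have below_lt a b : lt a b -> (#|below a| < #|below b|)%N.
  move=> ab; apply: proper_card; apply/properP; split.
    by apply/fintype.subsetP=> c; rewrite !inE => /lt_tr; apply.
  by exists a; rewrite !inE ?lt_irr.
have rank_lt a : (#|below a| < n)%N.
  rewrite -[X in (_ < X)%N]card_ord -cardsT; apply: proper_card.
  by apply/properP; split; [exact: finset.subsetT | exists a; rewrite !inE ?lt_irr].
have rank_inj : injective (fun a => Ordinal (rank_lt a)).
  move=> a b [rab]; case/or3P: (lt_tot a b) => [/below_lt|/eqP //|/below_lt];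
    by rewrite rab ltnn.
exists (perm rank_inj) => a b; rewrite !permE /= => rab.
rewrite leNgt; apply/negP=> fba; have /below_lt : lt b a by rewrite /lt fba.
by rewrite ltnNge ltnW.
Qed.

(** The points are numbered by distance through [q], ties being broken arbitrarily: on one line
    different coordinates force different distances, so ties do no harm. *)
Lemma Geom_word n (s : 'S_n) : Geom R M n s ->
  exists (col : 'I_n -> 'I_t.*2) (row : 'I_n -> 'I_u.*2) sg sg',
  [/\ forall k, double_refinement M (col k) (row k) != 0,
      line_order col sg, line_order row sg' & s = (sg * sg'^-1)%g].
Proof.
case=> x [y [figxy xlt ylt]].
have /choice[z zP] : forall a, exists z : 'I_t.*2 * 'I_u.*2 * R,
    [/\ double_refinement M z.1.1 z.1.2 != 0, 0 <= z.2 < 2^-1,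
    x a = refined_coord z.1.1 z.2 & y a = refined_coord z.1.2 z.2].
  move=> a; have /standard_figureP[c [r [d H]]] := figxy a.
  by exists (c, r, d).
have [q qP] := rank_perm (fun a => (z a).2).
have qlt a b : (z a).2 < (z b).2 -> (q a < q b)%N.
  move=> zab; case: (ltngtP (q a) (q b)) => // [/qP|/val_inj/perm_inj ab].
    by rewrite leNgt zab.
  by rewrite ab ltxx in zab.
have lineP m (f : 'I_n -> 'I_m) (a b : 'I_n) :
    refined_coord (f a) (z a).2 < refined_coord (f b) (z b).2 ->
    line_lt (fun k => f ((q^-1)%g k)) (q a) (q b).
  case: (zP a) => _ za _ _; case: (zP b) => _ zb _ _.
  move/(ltr_refined_coord za zb); rewrite /line_lt !permK.
  case/orP=> [->//|/andP[-> ]]; case: (odd _) => /qlt ->; exact: orbT.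
(* Point [k] stands at position [q^-1 k], and the point at height [b] has number [q (s^-1 b)]. *)
exists (fun k => (z ((q^-1)%g k)).1.1), (fun k => (z ((q^-1)%g k)).1.2).
exists q, (s^-1 * q)%g; split.
- by move=> k; case: (zP ((q^-1)%g k)).
- move=> a b /xlt xab; apply: (lineP _ (fun a => (z a).1.1)).
  by case: (zP a) => _ _ <- _; case: (zP b) => _ _ <- _.
- move=> a b ab; rewrite !permM; apply: (lineP _ (fun a => (z a).1.2)).
  case: (zP ((s^-1)%g a)) => _ _ _ <-; case: (zP ((s^-1)%g b)) => _ _ _ <-.
  by rewrite ylt !permKV.
- by rewrite invMg invgK mulKVg.
Qed.

Lemma word_Geom n (col : 'I_n -> 'I_t.*2) (row : 'I_n -> 'I_u.*2) :
  (forall k, double_refinement M (col k) (row k) != 0) ->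
  exists sg sg', [/\ line_order col sg, line_order row sg'
    & Geom R M n (sg * sg'^-1)%g].
Proof.
(* Distances that increase with the number and lie strictly between 0 and 1/2, so that no point
   falls on a centre or a corner. *)
move=> Mcr; pose d (k : 'I_n) : R := k.+1%:R / (n.+1.*2)%:R.
have d12 k : 0 < d k < 2^-1.
  rewrite divr_gt0 ?ltr0n //= ltr_pdivrMr ?ltr0n // -mul2n natrM mulKf ?pnatr_eq0 //.
  by rewrite ltr_nat ltnS.
have d_lt (k l : 'I_n) : (k < l)%N -> d k < d l.
  by move=> kl; rewrite ltr_pM2r ?invr_gt0 ?ltr0n // ltr_nat ltnS.
have lineP m (f : 'I_n -> 'I_m) k l : line_lt f k l ->
    refined_coord (f k) (d k) < refined_coord (f l) (d l).
  move=> H; apply: refined_coord_lt => //; move: H; rewrite /line_lt.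
  by case/orP=> [->//|/andP[-> ]]; case: (odd _) => /d_lt ->; rewrite orbT.
have line_tot m (f : 'I_n -> 'I_m) k l : k != l -> line_lt f k l || line_lt f l k.
  rewrite /line_lt -(inj_eq val_inj) /=.
  case: (ltngtP (f k) (f l)) => //= [/val_inj ->].
  by case: (odd _); case: (ltngtP k l).
have sortP m (f : 'I_n -> 'I_m) : exists sg, line_order f sg.
  have [q qP] := rank_perm (fun k => refined_coord (f k) (d k)).
  exists (q^-1)%g => a b ab; have := line_tot m f ((q^-1)%g a) ((q^-1)%g b).
  rewrite (inj_eq perm_inj) -(inj_eq val_inj) /= ltn_eqF //= => /(_ isT).
  case/orP=> // /lineP; rewrite ltNge qP //; by rewrite !permKV.
have [sg csg] := sortP _ col; have [sg' rsg'] := sortP _ row.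
exists sg, sg'; split=> //.
exists (fun a => refined_coord (col (sg a)) (d (sg a))).
exists (fun a => refined_coord (row (sg a)) (d (sg a))); split.
- move=> a; apply/standard_figureP.
  exists (col (sg a)), (row (sg a)), (d (sg a)); split=> //.
  by case/andP: (d12 (sg a)) => /ltW -> ->.
- by move=> a b /csg/lineP.
have row_lt (a b : 'I_n) : (a < b)%N -> refined_coord (row (sg' a)) (d (sg' a)) <
                               refined_coord (row (sg' b)) (d (sg' b)).
  by move=> /rsg'/lineP.
move=> a b; rewrite !permM; set a' := (sg'^-1)%g _; set b' := (sg'^-1)%g _.
have -> : sg a = sg' a' by rewrite permKV.
have -> : sg b = sg' b' by rewrite permKV.
case: (ltngtP a' b') => [/row_lt //|/row_lt|/val_inj ->]; last by rewrite ltxx.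
by move=> ba; apply/negbTE; rewrite -leNgt ltW.
Qed.

End Figure.

(** * Comparing the numbers of permutations and of traces *)

Section Counting.
Variables (R : realType) (t u : nat) (M : 'M[int]_(t, u)).
Hypothesis M01 : zpm1_matrix M.

Local Notation G := (row_column_graph (double_refinement M)).

Lemma edge_edges x : (edge x \in edges G) = (double_refinement M x.1 x.2 != 0).
Proof.
rewrite inE; apply/existsP/idP=> [[v /existsP[w /andP[]]]|Mx]; last first.
  by exists (inl x.1); apply/existsP; exists (inr x.2); rewrite /= Mx eqxx.
case: v w => [c|r] [c'|r'] //= Mcr /eqP ex.
- have := mem_edge_inl c x; have := mem_edge_inr r' x.
  by rewrite ex !inE !eqxx ?orbT => /esym/eqP -> /esym/eqP ->.
- have := mem_edge_inl c' x; have := mem_edge_inr r x.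
  by rewrite ex !inE !eqxx ?orbT => /esym/eqP -> /esym/eqP ->.
Qed.

Lemma edgesP a : a \in edges G ->
  exists2 x, a = edge x & double_refinement M x.1 x.2 != 0.
Proof.
rewrite inE => /existsP[[c|r] /existsP[[c'|r'] /andP[//= Mcr /eqP ->]]].
  by exists (c, r').
by exists (c', r) => //; rewrite finset.setUC.
Qed.

Definition gridding_spec n (s : 'S_n) x
    (f : {ffun 'I_n -> 'I_t.*2} * {ffun 'I_n -> 'I_u.*2}) :=
  [/\ line_mono f.1, line_mono f.2, cell_mono s f.1 f.2
    & x = gridded_trace s f.1 f.2].

Lemma Geom_trace n (s : 'S_n) : Geom R M n s ->
  exists x, x \in traces (edges G) n /\ exists f, gridding_spec s x f.
Proof.
case/(Geom_word M01)=> col [row [sg [sg' [Mcr csg rsg ->]]]].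
exists (trace_of [seq edge (col k, row k) | k <- enum 'I_n]); split.
  rewrite -[X in traces _ X](size_enum_ord n).
  rewrite -(size_map (fun k => edge (col k, row k))); apply: trace_of_traces.
  by apply/allP=> _ /mapP[k _ ->]; rewrite /= edge_edges; exact: Mcr.
exists (finfun (col \o sg), finfun (row \o sg')).
have cE : finfun (col \o sg) =1 col \o sg by exact: ffunE.
have rE : finfun (row \o sg') =1 row \o sg' by exact: ffunE.
split=> /=.
- by move=> a b ab; rewrite !cE; exact: (line_order_mono csg).
- by move=> a b ab; rewrite !rE; exact: (line_order_mono rsg).
- by move=> a b; rewrite !cE !rE; apply: line_order_cell_mono.
rewrite (trace_of_word csg rsg).
by congr gridded_trace; apply/esym/funext.
Qed.

Lemma trace_Geom n x : x \in traces (edges G) n ->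
  exists s : 'S_n, Geom R M n s /\ exists f, gridding_spec s x f.
Proof.
case/tracesP=> w [sw wE ->].
have /choice[z zP] : forall k : 'I_n, exists z : 'I_t.*2 * 'I_u.*2,
    nth finset.set0 w k = edge z /\ double_refinement M z.1 z.2 != 0.
  move=> k; have /edgesP[z ? ?] : nth finset.set0 w k \in edges G.
    by apply: (allP wE); rewrite mem_nth // sw.
  by exists z.
have [|sg [sg' [csg rsg sG]]] := @word_Geom R _ _ _ M01 n (fst \o z) (snd \o z).
  by move=> k; case: (zP k).
exists (sg * sg'^-1)%g; split=> //.
have cE : finfun ((fst \o z) \o sg) =1 (fst \o z) \o sg by exact: ffunE.
have rE : finfun ((snd \o z) \o sg') =1 (snd \o z) \o sg' by exact: ffunE.
exists (finfun ((fst \o z) \o sg), finfun ((snd \o z) \o sg')); split=> /=.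
- by move=> a b ab; rewrite !cE; exact: (line_order_mono csg).
- by move=> a b ab; rewrite !rE; exact: (line_order_mono rsg).
- by move=> a b; rewrite !cE !rE; apply: line_order_cell_mono.
have -> : w = [seq edge ((fst \o z) k, (snd \o z) k) | k <- enum 'I_n].
  rewrite -[LHS](mkseq_nth finset.set0) sw /mkseq -val_enum_ord -map_comp.
  by apply: eq_map => k /=; case: (zP k) => -> _; rewrite -surjective_pairing.
rewrite (trace_of_word csg rsg).
by congr gridded_trace; apply/esym/funext.
Qed.

Lemma Geom_count_le n : (Geom_count R M n <= num_traces (edges G) n)%N.
Proof.
pose good (s : 'S_n) x := x \in traces (edges G) n /\ exists f, gridding_spec s x f.
have /choice[F FP] : forall s : 'S_n, exists x, Geom R M n s -> good s x.
  move=> s; have [/Geom_trace[x]|] := pselect (Geom R M n s); first by exists x.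
  by exists (trace_nil _).
rewrite /Geom_count cardE -(size_map F); apply: uniq_leq_size.
  rewrite map_inj_in_uniq ?enum_uniq // => s s'; rewrite !mem_enum.
  move=> /asboolP sG /asboolP sG' ss'.
  have [_ [f [? ? ? fE]]] := FP _ sG; have [_ [f' [? ? ? fE']]] := FP _ sG'.
  apply: (@gridded_trace_inj _ _ _ s s' f.1 f'.1 f.2 f'.2) => //.
  by rewrite -fE ss' fE'.
by move=> x /mapP[s]; rewrite mem_enum => /asboolP/FP[xE _] ->.
Qed.

(* A gridding is determined by the numbers of points in the rows and columns. *)
Definition line_counts n m (f : 'I_n -> 'I_m) : {ffun 'I_m -> 'I_n.+1} :=
  [ffun c => inord (count_mem c [seq f a | a <- enum 'I_n])].

Lemma line_counts_inj n m (f f' : 'I_n -> 'I_m) : line_mono f -> line_mono f' ->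
  line_counts f = line_counts f' -> f =1 f'.
Proof.
move=> fm fm' /ffunP ff'.
have cnt g c : (count_mem c [seq g a : 'I_m | a <- enum 'I_n] < n.+1)%N.
  by rewrite ltnS (leq_trans (count_size _ _)) // size_map size_enum_ord.
suff /eq_in_map E : [seq f a | a <- enum 'I_n] = [seq f' a | a <- enum 'I_n].
  by move=> a; apply: E; rewrite mem_enum.
apply: (sorted_eq (leT := fun c d : 'I_m => (c <= d)%N)).
- by move=> c d e; exact: leq_trans.
- by move=> c d cd; apply: val_inj; exact: anti_leq.
- by rewrite sorted_map; apply: sub_sorted (@ord_ltn_sorted n) => a b /fm.
- by rewrite sorted_map; apply: sub_sorted (@ord_ltn_sorted n) => a b /fm'.
apply/allP=> c _; have /(congr1 val) := ff' c; rewrite !ffunE /= !inordK ?cnt //.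
by move=> /eqP.
Qed.

Definition line_monos n m :=
  [set f : {ffun 'I_n -> 'I_m} | `[< line_mono f >]]%SET.

Lemma card_line_monos n m : (#|line_monos n m| <= n.+1 ^ m)%N.
Proof.
rewrite -[X in (X ^ _)%N]card_ord -[X in (_ ^ X)%N]card_ord -card_ffun.
rewrite -(card_in_imset (f := fun f : {ffun _} => line_counts f)) ?max_card //.
move=> f f'; rewrite !inE => fm fm' ff'.
by apply/ffunP; apply: line_counts_inj => //; apply/asboolP.
Qed.

(** Every trace is read off from a permutation of the class and a pair of monotone functions, and
    [card_line_monos] bounds the number of such pairs. *)
Lemma num_traces_le n : (num_traces (edges G) n <=
  Geom_count R M n * n.+1 ^ (t.*2 + u.*2))%N.
Proof.
pose P := finset.setX (line_monos n t.*2) (line_monos n u.*2).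
apply: (@leq_trans (Geom_count R M n * #|P|)); last first.
  by rewrite leq_mul2l cardsX expnD leq_mul ?card_line_monos ?orbT.
rewrite /Geom_count !cardE.
rewrite -(size_allpairs (fun (s : 'S_n)
  (f : {ffun 'I_n -> 'I_t.*2} * {ffun 'I_n -> 'I_u.*2}) => gridded_trace s f.1 f.2)).
apply: uniq_leq_size; first exact: traces_uniq.
move=> x /trace_Geom[s [sG [f [fm1 fm2 _ ->]]]]; apply/allpairsP.
exists (s, f); split=> //=; rewrite mem_enum; first exact/asboolP.
by rewrite !inE; apply/andP; split; apply/asboolP.
Qed.

End Counting.

(** * Growth rates from exponential bounds *)

Section GrowthRate.
Variable R : realType.

Lemma exp_domination (a b C : R) : 0 <= a -> a < b ->
  (\forall n \near \oo, C * a ^+ n <= b ^+ n)%classic.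
Proof.
move=> a0 ab; have b0 : 0 < b by apply: le_lt_trans ab.
have q1 : `|a / b| < 1.
  by rewrite ger0_norm ?divr_ge0 ?(ltW b0) // ltr_pdivrMr // mul1r.
have C1 : 0 < `|C| + 1 by rewrite ltr_wpDl.
have /cvgr0_norm_lt/(_ (`|C| + 1)^-1) := cvg_expr q1.
rewrite invr_gt0 => /(_ C1); apply: filterS => n.
rewrite ger0_norm ?exprn_ge0 ?divr_ge0 ?(ltW b0) // expr_div_n.
rewrite ltr_pdivrMr ?exprn_gt0 // mulrC ltr_pdivlMr // => H.
apply: le_trans (ltW H); rewrite mulrC ler_wpM2l ?exprn_ge0 //.
by rewrite (le_trans (ler_norm _)) // lerDl.
Qed.

(** Bernoulli's inequality gives [n * (s - 1) <= s ^+ n], hence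
    [n + 1 <= ((s - 1)^-1 + 1) * s ^+ n], which is raised to the power [D]. *)
Lemma poly_exp_bound (s : R) (D : nat) : 1 < s ->
  exists B : R, 0 <= B /\ forall n, n.+1%:R ^+ D <= B * (s ^+ D) ^+ n.
Proof.
move=> s1; have h0 : 0 < s - 1 by rewrite subr_gt0.
have bern n : 1 + n%:R * (s - 1) <= s ^+ n.
  elim: n => [|n IHn]; first by rewrite mul0r addr0 expr0.
  rewrite exprS; apply: le_trans (ler_wpM2l (ltW (lt_trans ltr01 s1)) IHn).
  have : 0 <= n%:R * (s - 1) ^+ 2 by rewrite mulr_ge0 // sqr_ge0.
  rewrite -natr1; nra.
exists (((s - 1)^-1 + 1) ^+ D); split.
  by rewrite exprn_ge0 // addr_ge0 // invr_ge0 ltW.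
move=> n; rewrite -exprM mulnC exprM -exprMn lerXn2r ?nnegrE //.
  by rewrite mulr_ge0 ?exprn_ge0 ?addr_ge0 ?invr_ge0 ?ltW // (lt_trans ltr01).
rewrite mulrDl mul1r -natr1 lerD //.
  rewrite mulrC ler_pdivlMr //; apply: le_trans (bern n); by rewrite lerDr.
by rewrite exprn_ege1 // ltW.
Qed.

Lemma growth_rate_of_bounds (g : nat -> nat) (L : R) : 0 < L ->
  (forall r, 0 < r -> r < L -> exists B : R, forall n, r ^+ n <= B * (g n)%:R) ->
  (forall r, L < r -> exists C : R, forall n, (g n)%:R <= C * r ^+ n) ->
  has_growth_rate g L.
Proof.
move=> L0 lower upper; apply/cvgrPdist_lt => eps eps0.
have rootX r n : 0 <= r -> (0 < n)%N -> (r ^+ n) `^ (n%:R)^-1 = r.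
  move=> r0 n0; rewrite -powR_mulrn // -powRrM divff ?powRr1 //.
  by rewrite pnatr_eq0 -lt0n.
have [r [r0 rL rE]] : exists r, [/\ 0 < r, r < L & L - eps < r].
  have [h|h] := lerP L eps; first by exists (L / 2); split; lra.
  by exists (L - eps / 2); split; lra.
(* The bases [(r + L) / 2] and [L + eps / 3] lie closer to [L] than [r] and [L + eps / 2]; the gaps
   absorb the constants [B] and [C] for large [n]. *)
have [B BP] := lower ((r + L) / 2) ltac:(lra) ltac:(lra).
have [C CP] := upper (L + eps / 3) ltac:(lra).
have B0 : 0 < B.
  have := BP 0%N; rewrite expr0; case: ltP => // B0.
  by have := mulr_le0_ge0 B0 (ler0n R (g 0%N)); lra.
have low : (\forall n \near \oo, B * r ^+ n <= ((r + L) / 2) ^+ n)%classic.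
  by apply: exp_domination; lra.
have upp : (\forall n \near \oo,
    C * (L + eps / 3) ^+ n <= (L + eps / 2) ^+ n)%classic.
  by apply: exp_domination; lra.
near=> n.
have n0 : (0 < n)%N by near: n; exact: nbhs_infty_gt.
have rg : r ^+ n <= (g n)%:R.
  by rewrite -(ler_pM2l B0); apply: le_trans (BP n); near: n.
have gr : (g n)%:R <= (L + eps / 2) ^+ n.
  by apply: (le_trans (CP n)); near: n.
have i0 : 0 <= (n%:R)^-1 :> R by rewrite invr_ge0.
have rn0 : 0 <= r ^+ n by rewrite exprn_ge0 // ltW.
have := ge0_ler_powR i0 rn0 (le_trans rn0 rg) rg.
rewrite rootX ?(ltW r0) // => lo.
have Ln0 : 0 <= (L + eps / 2) ^+ n by rewrite exprn_ge0 //; lra.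
have := ge0_ler_powR i0 (ler0n R (g n)) Ln0 gr.
rewrite rootX //; last by lra.
by move=> hi; rewrite ltr_distlC; apply/andP; split; lra.
Unshelve. all: by end_near.
Qed.

End GrowthRate.

(** * The edgeless case and the theorem *)

Lemma num_matchings_set0 (V : finType) k :
  num_matchings (finset.set0 : {set {set V}}) k = (k == 0)%N.
Proof.
case: k => [|k].
  rewrite /num_matchings (_ : finset _ = [set finset.set0]%SET) ?cards1 //.
  have tS : finset.trivIset (finset.set0 : {set {set V}}).
    by apply/finset.trivIsetP=> a; rewrite inE.
  apply/finset.setP=> C; rewrite !inE cards_eq0 finset.subset0.
  by case: eqP => //= ->; rewrite tS.
rewrite /num_matchings; apply/eqP; rewrite cards_eq0; apply/eqP/finset.setP=> C.
by rewrite !inE finset.subset0; case: eqP => //= ->; rewrite cards0 andbF.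
Qed.

Lemma matching_poly_no_edges (R : realType) (V : finType) (e : rel V) :
  edges e = finset.set0 -> matching_poly R e = 'X^#|V|.
Proof.
move=> e0; rewrite /matching_poly big_ord_recl big1 => [|k _].
  rewrite -/(num_matchings (edges e) 0) e0 num_matchings_set0.
  by rewrite expr0 mul1r scale1r muln0 subn0 addr0.
rewrite -/(num_matchings (edges e) _) e0 num_matchings_set0.
by rewrite mulr0 scale0r.
Qed.

Lemma num_traces_no_edges (V : finType) n :
  num_traces (finset.set0 : {set {set V}}) n.+1 = 0%N.
Proof.
rewrite /num_traces; case E: (traces _ n.+1) => [//|x z].
have : x \in traces finset.set0 n.+1 by rewrite E mem_head.
by case/tracesP=> -[|a w] [] //= _ /andP[]; rewrite inE.
Qed.

Theorem theorem2 (R : realType) (t u : nat) (M : 'M[int]_(t, u)) :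
  (0 < t)%N -> (0 < u)%N -> zpm1_matrix M ->
  exists z : R,
    largest_root
      (matching_poly R (row_column_graph (double_refinement M))) z /\
    has_growth_rate (Geom_count R M) (z ^+ 2).
Proof.
move=> t0 u0 M01; set e := row_column_graph _.
have e_irr : irreflexive e by exact: row_column_graph_irr.
have [e0|En0] := eqVneq (edges e) finset.set0.
  (* Without edges the matching polynomial is a positive power of the indeterminate, with 0 as its
     only root, and the class has no permutation of positive length. *)
  exists 0; split.
    rewrite (matching_poly_no_edges R e0); split.
      rewrite rootE hornerXn expf_eq0 eqxx andbT card_sum !card_ord; lia.
    move=> w; rewrite rootE hornerXn expf_eq0 => /andP[_ /eqP ->]; exact: lexx.
  rewrite expr0n /=; apply: cvg_near_cst; near=> n.
  have n0 : (0 < n)%N by near: n; exact: nbhs_infty_gt.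
  have : (Geom_count R M n <= num_traces (edges e) n)%N by exact: Geom_count_le.
  rewrite e0 -[X in num_traces _ X](prednK n0) num_traces_no_edges leqn0 => /eqP ->.
  by rewrite powR0 // invr_eq0 pnatr_eq0 -lt0n.
have [L [L1 LT rT zP]] := matching_growth_rate R e_irr En0.
have L0 : 0 < L by apply: lt_le_trans L1.
exists (Num.sqrt L); split=> //; rewrite sqr_sqrtr ?ltW //.
apply: growth_rate_of_bounds => // r r0; last first.
  have [C CP] := rT r r0; exists C => n; apply: le_trans (CP n).
  by rewrite ler_nat Geom_count_le.
move=> rL; pose D := (t.*2 + u.*2)%N.
have D0 : (0 < D)%N by rewrite /D; lia.
(* Chosen with [s ^+ D = L / r], so that the factor [n.+1 ^ D] between traces and permutations costs
   at most [B * (L / r) ^+ n] and lowers the base from [L] to [r]. *)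
pose s := (L / r) `^ (D%:R)^-1.
have sD : s ^+ D = L / r.
  rewrite -powR_mulrn ?powR_ge0 // -powRrM mulVf ?powRr1 // ?divr_ge0 ?ltW //.
  by rewrite pnatr_eq0 -lt0n.
have s1 : 1 < s.
  rewrite ltNge; apply/negP=> s1; have := exprn_ile1 D (powR_ge0 _ _) s1.
  by rewrite sD ler_pdivrMr // mul1r leNgt rL.
have [B [B0 BP]] := poly_exp_bound D s1; exists B => n.
rewrite -(ler_pM2r (x := (L / r) ^+ n)) ?exprn_gt0 ?divr_gt0 //.
rewrite -exprMn mulrCA divff ?gt_eqF // mulr1; apply: le_trans (LT n) _.
apply: (le_trans (y := (Geom_count R M n)%:R * n.+1%:R ^+ D)).
  by rewrite -natrX -natrM ler_nat num_traces_le.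
by rewrite mulrC -sD -mulrA [X in _ <= B * X]mulrC mulrA ler_wpM2r.
Unshelve. all: by end_near.
Qed.
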